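(* Let $m,n$ be positive integers with $\sum_{j=1}^m j^n=(m+1)^n$. If $m\equiv 1\pmod 3$, then $m\equiv 1\pmod{3^7}$.
   Context: The equation $\sum_{j=1}^m j^n=(m+1)^n$ is the Erdős–Moser equation. *)

(* Defs.v *)
From mathcomp Require Export all_boot.

(* Main.v *)
Require Import Defs.
From Stdlib Require Import NArith FMapPositive.
From mathcomp Require Import all_boot cyclic zify.

Set Implicit Arguments.
Unset Strict Implicit.
Unset Printing Implicit Defensive.

(** Write the equation as S_n(m + 1) = (m + 1)^n, where S_n(N) is the sum of
    the j^n over j < N, and suppose that m = 3q + 1.  Modulo 3 the equation
    forces n to be even.  The proof then rests on the divisibility of n by 3^5.
    Once that is known, n is a multiple of 2 * 3^5, the order of the group of
    units modulo 3^6, so that j^n is 0 modulo 3^6 if 3 divides j and 1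
    otherwise.  The equation modulo 3^6 then reads 2q + 1 = 1, whence 3^6
    divides q and m = 1 modulo 3^7.

    To show that 3^5 divides n, residue classes of n are excluded one by one
    with auxiliary primes p ([helpful_exclusion]).  If n = r modulo p - 1, then
    modulo p both sides of the equation depend only on r and on m + 1 modulo p;
    for suitable p and r a finite computation shows that they differ whenever p
    does not divide m + 1.  A prime p dividing m + 1 is severely restricted:
    Voronoi's congruence for the multiplier 2, worked out modulo the power of p
    just above that in n (m + 1), shows that p divides the sum of j^(n-1) over
    the odd j < p ([odd_power_sum_dvd_of_dvd]), which up to a factor 2^n - 1 is
    a condition on the Bernoulli number quotient B_n / n.  It again depends only
    on r modulo p - 1.

    A pair (p, r) for which both conditions can be refuted is called helpful.
    An explicit tree of residue classes, whose leaves carry helpful primes, then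
    shows successively that n is divisible by 4, 8, 24, 120, ... and finally by
    97297200 = 2^4 * 3^5 * 5^2 * 7 * 11 * 13.  The detour through the other
    primes is what makes helpful primes available: p is useful for a class
    modulo M only if p - 1 divides M. *)

(** * Congruences for sums and power sums *)

Definition power_sum (n N : nat) := \sum_(j < N) j ^ n.

Lemma eq_mod_sum d k (F G : nat -> nat) :
  (forall i, F i = G i %[mod d]) -> \sum_(i < k) F i = \sum_(i < k) G i %[mod d].
Proof.
move=> FG; rewrite -modn_summ -[RHS]modn_summ.
by congr (_ %% d); apply: eq_bigr => i _; exact: FG.
Qed.

Lemma eq_mod_exp d a b k : a = b %[mod d] -> a ^ k = b ^ k %[mod d].
Proof. by move=> ab; rewrite -modnXm ab modnXm. Qed.

Lemma eq_mod_add d a b a' b' :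
  a = b %[mod d] -> a' = b' %[mod d] -> a + a' = b + b' %[mod d].
Proof. by move=> ab ab'; rewrite -modnDm ab ab' modnDm. Qed.

Lemma eq_mod_mul d a b a' b' :
  a = b %[mod d] -> a' = b' %[mod d] -> a * a' = b * b' %[mod d].
Proof. by move=> ab ab'; rewrite -modnMm ab ab' modnMm. Qed.

Lemma sum_ord_add (f : nat -> nat) a b :
  \sum_(j < a + b) f j = \sum_(j < a) f j + \sum_(j < b) f (a + j).
Proof. by rewrite big_split_ord. Qed.

Lemma sum_periodic_mod d p (f : nat -> nat) k x :
    (forall j, f (p + j) = f j %[mod d]) ->
  \sum_(j < k * p + x) f j
    = k * (\sum_(j < p) f j) + \sum_(j < x) f j %[mod d].
Proof.
move=> fp; elim: k => [|k IHk]; first by rewrite !mul0n.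
rewrite !mulSn -!addnA sum_ord_add; apply: eq_mod_add => //.
by rewrite -IHk; apply: (@eq_mod_sum _ _ (fun j => f (p + j))).
Qed.

Lemma exp_shift_mod d k j : (d + j) ^ k = j ^ k %[mod d].
Proof. by apply: eq_mod_exp; rewrite modnDl. Qed.

Lemma power_sum_mod d n k x :
  power_sum n (k * d + x) = k * power_sum n d + power_sum n x %[mod d].
Proof.
by apply: (@sum_periodic_mod _ _ (fun j => j ^ n)) => j; exact: exp_shift_mod.
Qed.

Lemma dvdn_addX a b k : odd k -> a + b %| a ^ k + b ^ k.
Proof.
move=> k_odd; rewrite -(odd_double_half k) k_odd -mul2n !expnS !expnM.
have sq: a ^ 2 = b ^ 2 %[mod a + b].
  apply/eqP; rewrite -(eqn_modDr (a * b)) -!mulnn -mulnDr -mulnDl.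
  by rewrite [b + a]addnC modnMl modnMr.
rewrite /dvdn -(@eq_mod_add _ (a * (a ^ 2) ^ k./2) _ (b * (a ^ 2) ^ k./2)) //.
  by rewrite -mulnDl modnMr.
by apply: eq_mod_mul => //; apply: eq_mod_exp.
Qed.

(** Pairing each term with its mirror image shows that d divides twice the
    sum, and d is odd. *)
Lemma dvdn_sum_reflect d k (f : nat -> nat) :
    odd d -> (forall j, j < k -> d %| f (k - j.+1) + f j) ->
  d %| \sum_(j < k) f j.
Proof.
move=> d_odd mirror; rewrite -(@Gauss_dvdr _ 2) ?coprimen2 //.
rewrite mul2n -addnn [X in X + _](reindex_inj rev_ord_inj) -big_split /=.
by apply: dvdn_sum => j _; apply: mirror.
Qed.

Lemma odd_exponent_power_sum_dvd k d : odd k -> odd d -> d %| power_sum k d.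
Proof.
move=> k_odd d_odd.
(* With the term j = d added, the mirror image of j is d - j. *)
suff: d %| power_sum k d.+1.
  by rewrite /power_sum big_ord_recr dvdn_addl // dvdn_exp // odd_gt0.
apply: (@dvdn_sum_reflect _ _ (fun j => j ^ k)) => // j lt_jd; rewrite subSS.
by rewrite -{1}(subnK (lt_jd : j <= d)) dvdn_addX.
Qed.

Definition odd_power_sum (n N : nat) := \sum_(j < N | odd j) j ^ n.

Lemma odd_power_sumE n N :
  odd N -> odd_power_sum n N = \sum_(i < N./2) i.*2.+1 ^ n.
Proof.
move=> N_odd; have {1}-> : N = N./2.*2.+1 by rewrite -[LHS]odd_double_half N_odd.
rewrite /odd_power_sum; elim: N./2 => [|h IHh].
  by rewrite big_mkcond big_ord_recr !big_ord0.
rewrite [RHS]big_ord_recr -IHh big_mkcond 2!big_ord_recr -big_mkcond /=.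
by rewrite negbK odd_double addn0.
Qed.

Lemma expnD_linear x z n :
  (x + z) ^ n.+1 = x ^ n.+1 + n.+1 * x ^ n * z
    + \sum_(i < n) 'C(n.+1, i.+2) * (x ^ (n - i.+1) * z ^ i.+2).
Proof.
rewrite expnDn big_ord_recl big_ord_recl /= bin0 bin1 subn0 subn1 /=.
rewrite mul1n muln1 expn1 mulnA addnA.
by congr (_ + _); apply: eq_bigr => i _; rewrite subSS.
Qed.

(** * Primes dividing m + 1 *)

Section OddPrime.
Variables (p : nat) (p_pr : prime p) (p_odd : odd p).

Let p_gt2 : 2 < p. Proof. exact: odd_prime_gt2. Qed.
Let p_gt0 : 0 < p. Proof. exact: prime_gt0. Qed.

Lemma prime_expD_mod s x z :
  0 < s -> p ^ s %| z ->
  (x + z) ^ p = x ^ p + p * x ^ p.-1 * z %[mod p ^ s.+2].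
Proof.
move=> s_gt0 pz.
have dvdX k : p ^ (s * k) %| z ^ k by rewrite expnM dvdn_exp2r.
rewrite -(prednK p_gt0) expnD_linear (prednK p_gt0) -modnDmr.
rewrite (eqP (_ : _ %| \sum_(i < p.-1) _)) ?addn0 //.
apply: dvdn_sum => i _; rewrite mulnCA dvdn_mull //.
(* The last coefficient is 1, but there z^p supplies p^(3s) since p > 2. *)
have [->|ip] := eqVneq (i.+2) p.
  apply: dvdn_mull; apply: dvdn_trans (dvdX _).
  by rewrite dvdn_exp2l // (@leq_trans (s * 3)) ?leq_mul2l ?p_gt2 ?orbT //; lia.
have lt_ip : i.+2 < p.
  by rewrite ltn_neqAle ip; have := ltn_ord i; lia.
rewrite expnS dvdn_mul //; first by rewrite prime_dvd_bin.
apply: dvdn_trans (dvdX _); by rewrite dvdn_exp2l //; nia.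
Qed.

Lemma prime_exp_lift_mod s a b :
  0 < s -> a = b %[mod p ^ s] -> a ^ p = b ^ p %[mod p ^ s.+1].
Proof.
move=> s_gt0; wlog le_ba: a b / b <= a => [IH|].
  by case/orP: (leq_total b a) => le_ab ab; [|symmetry]; apply: IH.
move/eqP; rewrite eqn_mod_dvd // => dvd_ab.
have dvdp : p ^ s.+1 %| p ^ s.+2 by rewrite dvdn_exp2l.
have /eqP lin0 : p ^ s.+1 %| p * b ^ p.-1 * (a - b).
  by rewrite -mulnA mulnCA dvdn_mull // expnS dvdn_mul.
rewrite -(subnKC le_ba) -(modn_dvdm _ dvdp) prime_expD_mod // (modn_dvdm _ dvdp).
by rewrite -modnDmr lin0 addn0.
Qed.

(** The terms of degree at least 2 in y gain, besides the factor n, one more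
    factor p.  Since the binomial coefficients do not show this factor n, the
    proof raises to the p-th power repeatedly, once for each factor p of n. *)
Lemma expD_linear_mod v e n P x y :
  0 < v -> p ^ v %| P -> p ^ e %| n -> 0 < n ->
  (x + P * y) ^ n = x ^ n + n * x ^ n.-1 * (P * y) %[mod p ^ (v + e).+1].
Proof.
move=> v_gt0 pP; elim: e n => [|e IHe] n en n_gt0.
  rewrite -(prednK n_gt0) expnD_linear /= -modnDmr.
  rewrite (eqP (_ : _ %| \sum_(i < n.-1) _)) ?addn0 //.
  apply: dvdn_sum => i _; do 2 apply: dvdn_mull.
  apply: dvdn_trans (_ : (p ^ v) ^ 2 %| _); last first.
    by rewrite (@dvdn_trans ((P * y) ^ 2)) ?dvdn_exp2l // dvdn_exp2r // dvdn_mulr.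
  by rewrite -expnM dvdn_exp2l //; lia.
have /dvdnP[n' def_n] : p %| n by rewrite (dvdn_trans _ en) // expnS dvdn_mulr.
have n'_gt0 : 0 < n' by move: n_gt0; rewrite def_n; case: (n').
have en' : p ^ e %| n' by rewrite -(dvdn_pmul2r p_gt0) -expnSr -def_n.
rewrite {1 2}def_n !expnM addnS (@prime_exp_lift_mod _ _ _ _ (IHe _ en' n'_gt0)) //.
have dvdZ : p ^ (v + e) %| n' * x ^ n'.-1 * (P * y).
  by rewrite expnD mulnC dvdn_mul // dvdn_mulr.
rewrite prime_expD_mod ?addn_gt0 ?v_gt0 //.
congr ((_ + _) %% _).
have -> : n.-1 = n' * p.-1 + n'.-1.
  by rewrite def_n -{1}(prednK p_gt0) mulnS addnC -{2}(prednK n'_gt0) addnS.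
rewrite def_n expnD expnM; clear; set A := _ ^ p.-1; lia.
Qed.

(** Expanding each block of length p^v to first order, the linear terms carry
    the factor n p^v S_(n-1)(p^v), and the last sum is divisible by p because
    n - 1 is odd. *)
Lemma power_sum_blocks v e n u :
  0 < v -> p ^ e %| n -> 0 < n -> ~~ odd n ->
  power_sum n (u * p ^ v) = u * power_sum n (p ^ v) %[mod p ^ (v + e).+1].
Proof.
move=> v_gt0 en n_gt0 n_even; set P := p ^ v.
elim: u => [|u IHu]; first by rewrite mul0n /power_sum big_ord0.
rewrite !mulSn [P + _]addnC [RHS in _ = RHS %[mod _]]addnC.
rewrite {1}/power_sum (sum_ord_add (fun j => j ^ n)).
apply: eq_mod_add; first exact: IHu.
have shift j :
    (u * P + j) ^ n = j ^ n + n * j ^ n.-1 * (P * u) %[mod p ^ (v + e).+1].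
  by rewrite addnC mulnC; apply: expD_linear_mod.
rewrite (eq_mod_sum _ shift) big_split /= -modnDmr -big_distrl -big_distrr /=.
suff /eqP -> : p ^ (v + e).+1 %| n * power_sum n.-1 P * (P * u) by rewrite addn0.
have -> : n * power_sum n.-1 P * (P * u) = n * power_sum n.-1 P * P * u by lia.
rewrite dvdn_mulr // -addSn addnC expnD -mulnA dvdn_mul // expnS dvdn_mul //.
have n1_odd : odd n.-1 by move: n_even; rewrite -{1}(prednK n_gt0) /= negbK.
apply: dvdn_trans (odd_exponent_power_sum_dvd n1_odd _); first exact: dvdn_exp.
by rewrite oddX p_odd orbT.
Qed.

(** Voronoi's congruence for the multiplier 2: among the doubles 2j of the
    j < P = p^v, those below P are the even residues, and the others are P + i
    with i running over the odd residues; expand (P + i)^n to first order. *)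
Lemma power_sum_double v e n :
  0 < v -> p ^ e %| n -> 0 < n ->
  2 ^ n * power_sum n (p ^ v)
    = power_sum n (p ^ v) + n * p ^ v * \sum_(i < (p ^ v)./2) (i.*2.+1) ^ n.-1
      %[mod p ^ (v + e).+1].
Proof.
move=> v_gt0 en n_gt0; set P := p ^ v; set h := P./2.
have def_P : P = h.+1 + h.
  by rewrite addSn addnn -[LHS]odd_double_half oddX p_odd orbT.
have -> : 2 ^ n * power_sum n P = \sum_(j < P) (j.*2) ^ n.
  by rewrite big_distrr /=; apply: eq_bigr => j _; rewrite -expnMn mul2n.
rewrite [in LHS]def_P (sum_ord_add (fun j => j.*2 ^ n)).
have shift i : (h.+1 + i).*2 ^ n
    = i.*2.+1 ^ n + n * i.*2.+1 ^ n.-1 * (P * 1) %[mod p ^ (v + e).+1].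
  have -> : (h.+1 + i).*2 = i.*2.+1 + P * 1 by rewrite def_P; lia.
  exact: expD_linear_mod.
rewrite -modnDmr (eq_mod_sum _ shift) modnDmr.
rewrite big_split /= -big_distrl -big_distrr /=.
rewrite addnA muln1 [n * P * _]mulnAC; congr ((_ + _) %% _).
rewrite /power_sum [in RHS]def_P.
elim: (h) => [|k IHk]; first by rewrite !big_ord_recl !big_ord0 !addn0.
rewrite addSn addnS [RHS]big_ord_recr [in RHS]big_ord_recr -IHk /=.
rewrite [in LHS]big_ord_recr [X in _ + X = _]big_ord_recr /=.
by rewrite addSn addnn doubleS; lia.
Qed.

(** Let p^v and p^e be the powers of p in N and in n, and q = p^(v+e+1).  As
    N^n vanishes modulo q, so does S_n(p^v), and [power_sum_double] leaves only
    n p^v times a sum over odd residues.  Cancelling p^(v+e) shows that p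
    divides that sum, which is periodic modulo p. *)
Lemma odd_power_sum_dvd_of_dvd n N :
  0 < N -> 0 < n -> ~~ odd n -> p %| N -> power_sum n N = N ^ n ->
  p %| odd_power_sum n.-1 p.
Proof.
rewrite odd_power_sumE // => N_gt0 n_gt0 n_even pN EM.
set v := logn p N; set e := logn p n.
have v_gt0 : 0 < v by rewrite logn_gt0 mem_primes p_pr N_gt0.
have en : p ^ e %| n by exact: pfactor_dvdnn.
(* This bound makes N^n vanish modulo p^(v+e+1). *)
have n_ge : e.+2 <= n.
  case: (posnP e) => [->|e_gt0]; first by move: n_gt0 n_even; case: (n) => [|[]].
  apply: leq_trans (dvdn_leq n_gt0 en); apply: leq_trans (_ : 3 ^ e <= _).
    by elim: (e) e_gt0 => // -[|k] // IHk _; rewrite expnS; have := IHk isT; lia.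
  by rewrite leq_exp2r.
have [u pu def_N] := pfactor_coprime p_pr N_gt0; rewrite -/v in def_N.
set P := p ^ v; set q := p ^ (v + e).+1.
have T0 : q %| power_sum n P.
  rewrite -(@Gauss_dvdr _ u) ?coprimeXl //.
  rewrite /dvdn -(power_sum_blocks u v_gt0 en n_gt0 n_even) -def_N EM.
  rewrite def_N expnMn -/(dvdn _ _) dvdn_mull // -expnM dvdn_exp2l //.
  by nia.
have := power_sum_double v_gt0 en n_gt0; rewrite -/P -/q => /eqP dbl.
have : q %| n * P * \sum_(i < P./2) i.*2.+1 ^ n.-1.
  rewrite -(dvdn_addr _ T0) /dvdn -(eqP dbl) -modnMmr (eqP T0).
  by rewrite muln0 mod0n.
have [n' pn' def_n] := pfactor_coprime p_pr n_gt0; rewrite -/e in def_n.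
rewrite /q expnS expnD {1}def_n.
have -> S : n' * p ^ e * P * S = n' * S * (p ^ v * p ^ e) by rewrite -/P; lia.
rewrite dvdn_pmul2r ?muln_gt0 ?expn_gt0 ?p_gt0 // Gauss_dvdr //.
have half_P : P./2 = (P %/ p)./2 * p + p./2.
  have /dvdnP[w def_P]: p %| P by rewrite dvdn_exp.
  have w_odd: odd w.
    have: odd P by rewrite oddX p_odd orbT.
    by rewrite def_P oddM => /andP[].
  have def_wp : w * p = (w./2 * p + p./2).*2.+1.
    rewrite -{1}(odd_double_half w) w_odd add1n mulSn -doubleMl doubleD.
    by rewrite -{1}(odd_double_half p) p_odd add1n addSn addnC.
  by rewrite def_P mulnK // def_wp /= uphalf_double.
have period j : (p + j).*2.+1 ^ n.-1 = j.*2.+1 ^ n.-1 %[mod p].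
  by rewrite doubleD -addnS -mul2n -modnXm modnMDl modnXm.
have n1_odd : odd n.-1 by move: n_even; rewrite -{1}(prednK n_gt0) /= negbK.
rewrite half_P /dvdn (@sum_periodic_mod _ _ (fun j => j.*2.+1 ^ n.-1)) //.
suff full : p %| \sum_(j < p) j.*2.+1 ^ n.-1.
  by rewrite -modnDml -modnMmr (eqP full) muln0 mod0n add0n.
apply: (@dvdn_sum_reflect _ _ (fun j => j.*2.+1 ^ n.-1)) => // j lt_jp.
apply: dvdn_trans (dvdn_addX _ _ n1_odd).
have -> : (p - j.+1).*2.+1 + j.*2.+1 = 2 * p by clear -lt_jp; lia.
exact: dvdn_mull.
Qed.
End OddPrime.

(** * Helpful pairs *)

Definition erdos_moser (m n : nat) := power_sum n m.+1 = m.+1 ^ n.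

(** For such a pair no solution of the equation has an even exponent congruent
    to r modulo p - 1: the walk condition refutes m + 1 = x modulo p for every
    nonzero x, and the last condition refutes m + 1 = 0.  The third condition
    makes S_r periodic modulo p. *)
Definition helpful (p r : nat) : Prop :=
  [/\ prime p && odd p, 0 < r, p %| power_sum r p,
      forall x, 0 < x < p -> power_sum r x <> x ^ r %[mod p] &
      ~ p %| odd_power_sum r.-1 p ].

Lemma coprime_exp_mod p a b j :
  prime p -> coprime j p -> a = b %[mod p.-1] -> j ^ a = j ^ b %[mod p].
Proof.
move=> p_pr cop ab.
have red k : j ^ k = j ^ (k %% p.-1) %[mod p].
  rewrite {1}(divn_eq k p.-1) expnD -[X in _ = X %[mod _]]mul1n.
  apply: eq_mod_mul => //.
  rewrite mulnC expnM -(exp1n (k %/ p.-1)); apply: eq_mod_exp.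
  by rewrite -(totient_prime p_pr) Euler_exp_totient.
by rewrite red ab -red.
Qed.

Lemma helpful_exclusion p r m n :
  helpful p r -> erdos_moser m n -> 0 < n -> ~~ odd n -> n <> r %[mod p.-1].
Proof.
move=> [/andP[p_pr p_odd] r_gt0 full walk half] EM n_gt0 n_even nr.
have p_gt0 := prime_gt0 p_pr.
have pow_nr j : j ^ n = j ^ r %[mod p].
  have [pj|npj] := boolP (p %| j).
    rewrite -modnXm (eqP pj) -[RHS]modnXm (eqP pj).
    by rewrite (exp0n n_gt0) (exp0n r_gt0).
  by apply: coprime_exp_mod => //; rewrite coprime_sym prime_coprime.
have sum_nr x : power_sum n x = power_sum r x %[mod p].
  by apply: (@eq_mod_sum _ _ (fun j => j ^ n) (fun j => j ^ r)) => j.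
have [pm|npm] := boolP (p %| m.+1).
  have := odd_power_sum_dvd_of_dvd p_pr p_odd (ltn0Sn m) n_gt0 n_even pm EM.
  suff eq_half : odd_power_sum n.-1 p = odd_power_sum r.-1 p %[mod p].
    by rewrite /dvdn eq_half.
  rewrite -modn_summ -[RHS]modn_summ; congr (_ %% p); apply: eq_bigr => i i_odd.
  apply: coprime_exp_mod => //; last first.
    by apply/eqP; rewrite -(eqn_modDr 1) !addn1 !prednK // nr.
  by rewrite coprime_sym prime_coprime // gtnNdvd // odd_gt0.
set x := m.+1 %% p; set k := m.+1 %/ p.
have def_m : m.+1 = k * p + x := divn_eq m.+1 p.
have full_n : p %| power_sum n p by rewrite /dvdn sum_nr.
have x_bounds : 0 < x < p by rewrite lt0n npm ltn_pmod.
apply: (walk x x_bounds); rewrite modnXm -pow_nr -EM def_m power_sum_mod -sum_nr.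
by rewrite -[in RHS]modnDml -modnMmr (eqP full_n) muln0 mod0n.
Qed.

(** * The equation modulo powers of 3 *)

(** For odd n the sum over a full period vanishes modulo 3, so that the
    equation would read 1 = 2 modulo 3. *)
Lemma even_exponent m n : erdos_moser m n -> 0 < n -> m = 1 %[mod 3] -> ~~ odd n.
Proof.
move=> EM n_gt0 m1; apply/negP => n_odd.
have def_m := divn_eq m 3; rewrite m1 in def_m.
have : power_sum n m.+1 = m.+1 ^ n %[mod 3] by rewrite EM.
have full : 3 %| power_sum n 3 by exact: odd_exponent_power_sum_dvd.
rewrite def_m -addnS power_sum_mod -modnDml -modnMmr (eqP full) muln0 mod0n.
rewrite -[RHS]modnXm modnMDl /power_sum !big_ord_recr big_ord0 /=.
rewrite exp0n // exp1n -[n]odd_double_half n_odd -mul2n expnD expnM.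
by rewrite -[RHS]modnMmr -[X in 2 ^ 1 * X]modnXm exp1n.
Qed.

Lemma exp_totient_multiple p k n j :
  prime p -> 0 < n -> k <= n -> totient (p ^ k) %| n ->
  j ^ n = ~~ (p %| j) %[mod p ^ k].
Proof.
move=> p_pr n_gt0 k_le /dvdnP[w def_n].
have [pj|npj] := boolP (p %| j).
  by rewrite mod0n; apply/eqP/(dvdn_trans (dvdn_exp2l p k_le)); apply: dvdn_exp2r.
rewrite def_n mulnC expnM -modnXm Euler_exp_totient ?modnXm ?exp1n //.
by rewrite coprime_sym coprimeXl // prime_coprime.
Qed.

Lemma count_non_multiples_of_3 q : \sum_(j < q * 3 + 2) ~~ (3 %| j) = 2 * q + 1.
Proof.
elim: q => [|k IHk]; first by rewrite !big_ord_recr big_ord0.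
rewrite mulSn -addnA (@sum_ord_add (fun j => ~~ (3 %| j) : nat)).
rewrite [X in _ + X](_ : _ = \sum_(j < k * 3 + 2) ~~ (3 %| j)); last first.
  by apply: eq_bigr => j _; rewrite dvdn_addr.
by rewrite IHk !big_ord_recr big_ord0 mulnS -!addnA.
Qed.

(** With m = 3q + 1, the equation modulo 3^6 counts the non-multiples of 3 up
    to m: it reads 2q + 1 = 1. *)
Lemma congruent_1_mod_3_7 m n :
  erdos_moser m n -> 0 < n -> ~~ odd n -> 3 ^ 5 %| n -> m = 1 %[mod 3] ->
  m = 1 %[mod 3 ^ 7].
Proof.
move=> EM n_gt0 n_even n3 m1.
have def_m := divn_eq m 3; rewrite m1 in def_m; set q := m %/ 3 in def_m.
have n_mult : totient (3 ^ 6) %| n.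
  by rewrite totient_pfactor // (@Gauss_dvd 2) // dvdn2 n_even.
have n_ge6 : 6 <= n by apply: leq_trans (dvdn_leq n_gt0 n_mult).
have pow j : j ^ n = ~~ (3 %| j) %[mod 3 ^ 6].
  exact: exp_totient_multiple.
have : power_sum n m.+1 = m.+1 ^ n %[mod 3 ^ 6] by rewrite EM.
rewrite pow {1}def_m /power_sum -addnS (eq_mod_sum _ pow) count_non_multiples_of_3.
have -> : ~~ (3 %| m.+1) by rewrite def_m -addnS dvdn_addr ?dvdn_mull.
move/eqP; rewrite -[X in _ == X %[mod _]]/(0 + 1) eqn_modDr mod0n => q2.
have q3 : 3 ^ 6 %| q by rewrite -(@Gauss_dvdr _ 2) ?coprimeXl.
have /eqP m3 : 3 ^ 7 %| q * 3 by rewrite expnSr dvdn_mul.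
by rewrite def_m -modnDml m3.
Qed.

(** * Testing helpful pairs in binary arithmetic *)

Local Notation toN := N.to_nat.

Lemma to_nat_add a b : toN (N.add a b) = toN a + toN b.
Proof. exact: N2Nat.inj_add. Qed.

Lemma to_nat_mul a b : toN (N.mul a b) = toN a * toN b.
Proof. exact: N2Nat.inj_mul. Qed.

Lemma to_nat_mod a b : toN (N.modulo a b) = toN a %% toN b.
Proof.
have [->|b_neq0] := N.eq_dec b 0; first by case: a.
have b_gt0 : 0 < toN b by lia.
have lt_mod : toN (N.modulo a b) < toN b by have := N.mod_lt a b b_neq0; lia.
rewrite [in RHS](N.div_mod' a b) to_nat_add to_nat_mul.
by rewrite mulnC modnMDl modn_small.
Qed.

Lemma to_nat_pos x : toN (Npos x) = Pos.to_nat x.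
Proof. by []. Qed.

Lemma pos_to_nat_succ x : Pos.to_nat (Pos.succ x) = (Pos.to_nat x).+1.
Proof. by lia. Qed.

Lemma pos_to_nat_xO x : Pos.to_nat (xO x) = (Pos.to_nat x).*2.
Proof. by lia. Qed.

Lemma pos_to_nat_xI x : Pos.to_nat (xI x) = (Pos.to_nat x).*2.+1.
Proof. by lia. Qed.

Fixpoint no_divisor_from (k : nat) (d p : N) : bool :=
  if k is k'.+1 then
    N.ltb p (N.mul d d)
    || ~~ N.eqb (N.modulo p d) 0 && no_divisor_from k' (N.succ d) p
  else false.

Lemma no_divisor_fromP k d p e :
  no_divisor_from k d p -> toN d <= e -> e * e <= toN p -> ~~ (e %| toN p).
Proof.
elim: k d => // k IHk d /= test le_de ee; case/orP: test => [lt_pdd|].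
  have : toN d * toN d <= e * e by exact: leq_mul.
  by have /N.ltb_lt := lt_pdd; lia.
case/andP=> d_ndiv rest; move: le_de; rewrite leq_eqVlt => /predU1P[<-|lt_de].
  by apply: contraNN d_ndiv => /eqP; rewrite -to_nat_mod => d0; apply/N.eqb_eq; lia.
by apply: IHk rest _ ee; rewrite N2Nat.inj_succ.
Qed.

(** Trial division up to 1001, hence conclusive for every p below 10^6. *)
Definition prime_test (p : N) := N.ltb 1 p && no_divisor_from 1000 2 p.

Lemma prime_testP p : prime_test p -> prime (toN p).
Proof.
case/andP=> /N.ltb_lt p_gt1 nodiv; have p1 : 1 < toN p by lia.
apply: ltn_pdiv2_prime; first exact: ltnW.
rewrite ltnNge; apply/negP => sq.
have := no_divisor_fromP (e := pdiv (toN p)) nodiv.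
rewrite pdiv_dvd mulnn => /(_ _ sq) H; apply: (elimN idP (H _)) => //.
by apply: prime_gt1; apply: pdiv_prime.
Qed.

Fixpoint pos_pow_mod (p b : N) (e : positive) : N :=
  match e with
  | xH => N.modulo b p
  | xO e' => let c := pos_pow_mod p b e' in N.modulo (N.mul c c) p
  | xI e' => let c := pos_pow_mod p b e' in
             N.modulo (N.mul b (N.modulo (N.mul c c) p)) p
  end.

Lemma pos_pow_modP p b e :
  toN (pos_pow_mod p b e) = toN b ^ Pos.to_nat e %% toN p.
Proof.
elim: e => [e IHe|e IHe|] /=.
- rewrite to_nat_mod to_nat_mul to_nat_mod to_nat_mul IHe pos_to_nat_xI.
  by rewrite modnMm -expnD addnn modnMmr -expnS.
- by rewrite to_nat_mod to_nat_mul IHe pos_to_nat_xO modnMm -expnD addnn.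
by rewrite to_nat_mod expn1.
Qed.

Definition pow_mod (p b e : N) : N :=
  if e is Npos e' then pos_pow_mod p b e' else N.modulo 1 p.

Lemma pow_modP p b e : toN (pow_mod p b e) = toN b ^ toN e %% toN p.
Proof. by case: e => [|e]; [exact: to_nat_mod | exact: pos_pow_modP]. Qed.

(** Walking through the powers x of g together with v = x^e, where c = g^e,
    costs two modular multiplications for each x, instead of a modular
    exponentiation. *)
Fixpoint power_table (k : nat) (p g c x v : N) (t : PositiveMap.t N) :=
  if k is k'.+1 then
    power_table k' p g c (N.modulo (N.mul x g) p) (N.modulo (N.mul v c) p)
      (if x is Npos q then PositiveMap.add q v t else t)
  else t.

Definition tabulates (e : nat) (p : N) (t : PositiveMap.t N) :=
  forall q v, PositiveMap.find q t = Some v -> toN v = Pos.to_nat q ^ e %% toN p.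

Lemma power_tableP e k p g c x v t :
  toN c = toN g ^ e %% toN p -> toN v = toN x ^ e %% toN p ->
  tabulates e p t -> tabulates e p (power_table k p g c x v t).
Proof.
move=> cE; elim: k x v t => //= k IHk x v t vE tE; apply: IHk.
  rewrite !to_nat_mod !to_nat_mul vE cE.
  by rewrite modnMml modnMmr modnXm expnMn.
case: x vE => [//|q] vE q' v'; rewrite PositiveMapAdditionalFacts.gsspec.
by case: PositiveMap.E.eq_dec => [-> [<-]|_] //; apply: tE.
Qed.

(** One pass over x = 1, ..., p - 1 with the running values s = S_(e+1)(x) and
    h, the sum of j^e over the odd j < x, both modulo p; [t] tabulates j^e. *)
Fixpoint walk_test (k : nat) (p : N) (t : PositiveMap.t N) (x : positive) (s h : N)
    : bool :=
  if k is k'.+1 then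
    if PositiveMap.find x t is Some v then
      let w := N.modulo (N.mul (Npos x) v) p in
      ~~ N.eqb s w &&
      walk_test k' p t (Pos.succ x) (N.modulo (N.add s w) p)
        (if N.odd (Npos x) then N.modulo (N.add h v) p else h)
    else false
  else N.eqb s 0 && ~~ N.eqb h 0.

Lemma odd_to_nat (x : positive) : odd (Pos.to_nat x) = N.odd (Npos x).
Proof.
case: x => [x|x|] //; first by rewrite pos_to_nat_xI oddS odd_double.
by rewrite pos_to_nat_xO odd_double.
Qed.

Lemma walk_testP e k p t x s h :
    tabulates e p t -> Pos.to_nat x + k = toN p ->
    toN s = power_sum e.+1 (Pos.to_nat x) %% toN p ->
    toN h = odd_power_sum e (Pos.to_nat x) %% toN p ->
    walk_test k p t x s h ->
  [/\ forall y, Pos.to_nat x <= y < toN p ->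
        power_sum e.+1 y <> y ^ e.+1 %[mod toN p],
      toN p %| power_sum e.+1 (toN p) & ~~ (toN p %| odd_power_sum e (toN p))].
Proof.
move=> tE; elim: k x s h => [|k IHk] x s h.
  rewrite addn0 => xp; rewrite xp => sE hE /andP[/N.eqb_eq s0 h0]; split.
  - by move=> y; case: leqP.
  - by rewrite /dvdn -sE s0.
  by apply: contraNN h0; rewrite /dvdn -hE => /eqP h0; apply/N.eqb_eq; lia.
move=> xp sE hE; cbn [walk_test]; case tx: PositiveMap.find => [v|] //.
case/andP=> s_neq_w rest.
have vE := tE _ _ tx.
set w := N.modulo (N.mul _ _) _ in s_neq_w rest.
have wE : toN w = Pos.to_nat x ^ e.+1 %% toN p.
  by rewrite to_nat_mod to_nat_mul vE to_nat_pos modnMmr expnS.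
case: (IHk _ _ _ _ _ _ rest).
- by rewrite pos_to_nat_succ -xp addSnnS.
- rewrite to_nat_mod to_nat_add sE wE modnDm pos_to_nat_succ.
  by rewrite /power_sum big_ord_recr.
- rewrite pos_to_nat_succ /odd_power_sum big_mkcond big_ord_recr -big_mkcond /=.
  rewrite odd_to_nat; case: N.odd; last by rewrite addn0.
  by rewrite to_nat_mod to_nat_add hE vE modnDm.
rewrite pos_to_nat_succ => walk full half; split=> // y /andP[].
rewrite leq_eqVlt => /predU1P[<- _|lt_xy lt_yp]; last by apply: walk; rewrite lt_xy.
rewrite -sE -wE => /N2Nat.inj sw; case/negP: s_neq_w; exact/N.eqb_eq.
Qed.

(** The base g should be a primitive root modulo p: the test fails if the powers
    of g miss a residue, as the lookup in the table then fails. *)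
Definition helpful_test (p g r : N) : bool :=
  [&& prime_test p, N.odd p, N.ltb 0 r &
    let t := power_table (toN (N.pred p)) p g (pow_mod p g (N.pred r)) 1 1
               (PositiveMap.empty N) in
    walk_test (toN (N.pred p)) p t 1 0 0].

Lemma helpful_testP p g r : helpful_test p g r -> helpful (toN p) (toN r).
Proof.
case/and4P=> /prime_testP p_pr p_odd /N.ltb_lt r_gt0 /=.
have p_gt1 := prime_gt1 p_pr.
have podd : odd (toN p) by case: (p) p_odd => // q; rewrite to_nat_pos odd_to_nat.
set e := toN (N.pred r); have rE : toN r = e.+1 by rewrite /e; lia.
have one : 1 = 1 %% toN p by rewrite modn_small.
have one_nat : Pos.to_nat xH = 1 by [].
move/walk_testP => /(_ e) [].
- apply: power_tableP; first exact: pow_modP.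
    by rewrite exp1n.
  by move=> q v; rewrite PositiveMap.gempty.
- by rewrite N2Nat.inj_pred; lia.
- by rewrite /power_sum one_nat big_ord_recr big_ord0 exp0n // mod0n.
- by rewrite /odd_power_sum one_nat big_mkcond big_ord_recr big_ord0 mod0n.
rewrite /helpful rE => walk full half; split=> //; first by rewrite p_pr.
exact/negP.
Qed.

(** * Sieving the exponent *)

(** A refutation tree for a residue class r modulo M of exponents: [Exclude p g] discards the
    class by the helpful pair (p, r modulo p - 1), with primitive root g;
    [Lift cs] splits it into the size of cs classes r + i M modulo M times that
    size; [Reached] marks a class contained in the multiples of 3^5. *)
Inductive sieve :=
  | Exclude of N & N
  | Lift of seq sieve
  | Reached.

Fixpoint sieve_test (r M : N) (c : sieve) : bool :=
  match c with
  | Exclude p g =>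
      N.eqb (N.modulo M (N.pred p)) 0 && helpful_test p g (N.modulo r (N.pred p))
  | Lift cs =>
      let M' := N.mul M (N.of_nat (size cs)) in
      (fix children (r : N) (cs : seq sieve) : bool :=
         if cs is c :: cs' then sieve_test r M' c && children (N.add r M) cs'
         else true) r cs && N.ltb 0 M'
  | Reached => N.eqb (N.modulo M 243) 0 && N.eqb (N.modulo r 243) 0
  end.

Fixpoint sieve_sound m n (c : sieve) {struct c} :
  erdos_moser m n -> 0 < n -> ~~ odd n ->
  forall r M, sieve_test r M c -> n = toN r %[mod toN M] -> 3 ^ 5 %| n.
Proof.
move=> EM n_gt0 n_even; case: c => [p g|cs|] r M /=.
- case/andP=> /N.eqb_eq M0 /helpful_testP helpful_pr nr.
  have p1E : toN (N.pred p) = (toN p).-1 by lia.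
  have dvdM : (toN p).-1 %| toN M by rewrite -p1E /dvdn -to_nat_mod M0.
  case: (helpful_exclusion helpful_pr EM n_gt0 n_even).
  by rewrite to_nat_mod p1E modn_mod -(modn_dvdm n dvdM) nr modn_dvdm.
- set M' := N.mul M _ => /andP[test /N.ltb_lt M'_gt0] nr.
  have M'E : toN M' = toN M * size cs by rewrite to_nat_mul Nat2N.id.
  have : exists2 i, i < size cs & n = toN r + i * toN M %[mod toN M'].
    have : 0 < toN M' by lia.
    rewrite M'E muln_gt0 => /andP[M_gt0 cs_gt0].
    (* Adding a multiple of the modulus makes the difference with r natural. *)
    pose n' := n + toN r * (toN M * size cs).
    have n'E : n' = n %[mod toN M * size cs] by rewrite /n' addnC modnMDl.
    have n'M : n' = toN r %[mod toN M].
      have dvdM : toN M %| toN M * size cs by apply: dvdn_mulr.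
      by rewrite -nr -(modn_dvdm n' dvdM) n'E modn_dvdm.
    have le_rn' : toN r <= n'.
      by rewrite (leq_trans _ (leq_addl _ _)) // leq_pmulr // muln_gt0 M_gt0.
    move/eqP: n'M; rewrite eqn_mod_dvd // => /dvdnP[q def_q].
    exists (q %% size cs); first exact: ltn_pmod.
    rewrite -n'E -(subnKC le_rn') def_q {1}(divn_eq q (size cs)).
    by rewrite mulnDl addnCA -mulnA [size cs * _]mulnC modnMDl.
  clearbody M'; case=> i.
  elim: cs r {nr M'E} test i => // c cs IHcs r /= /andP[c_test cs_test] [_|i].
    by rewrite mul0n addn0; exact: (sieve_sound m n c EM n_gt0 n_even).
  rewrite ltnS mulSn addnA -to_nat_add; exact: IHcs.
case/andP=> /N.eqb_eq M0 /N.eqb_eq r0 nr.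
have dvdM : 3 ^ 5 %| toN M by rewrite -[3 ^ 5]/(toN 243) /dvdn -to_nat_mod M0.
rewrite /dvdn -(modn_dvdm n dvdM) nr (modn_dvdm _ dvdM) -[3 ^ 5]/(toN 243).
by rewrite -to_nat_mod r0.
Qed.

(** Each stage, labelled by N and N l, takes a known divisor N of n to the
    multiple N l with l prime.  It lists the refutations of the classes t N
    modulo N l for t = 1, ..., l - 1; the class 0 is handed over to the next
    stage.  The order of the stages keeps the sum of the primes small, which
    governs the cost of the verification. *)
Definition exponent_sieve : sieve :=
  foldr (fun others zero_class => Lift (zero_class :: others)) Reached
  [::
    (* 2 to 4 *)
    [:: Exclude 5 2];
    (* 4 to 8 *)
    [:: Lift [:: Exclude 17 3; Exclude 17 3]];
    (* 8 to 24 *)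
    [:: Exclude 7 3; Exclude 7 3];
    (* 24 to 120 *)
    [:: Exclude 31 3; Exclude 31 3; Exclude 11 2; Exclude 11 2];
    (* 120 to 840 *)
    [:: Exclude 281 3; Exclude 29 2; Exclude 43 3; Exclude 43 3;
      Exclude 211 2; Exclude 421 2];
    (* 840 to 2520 *)
    [:: Lift [:: Exclude 109 6; Exclude 109 6; Exclude 379 2];
      Lift [:: Exclude 109 6; Exclude 109 6; Exclude 379 2]];
    (* 2520 to 5040 *)
    [:: Lift [:: Lift [:: Lift [:: Lift [:: Exclude 257 3; Exclude 257 3];
      Lift [:: Exclude 257 3; Exclude 769 11]]; Lift [:: Exclude 1153 5;
      Exclude 1153 5]]; Lift [:: Exclude 449 3; Exclude 449 3]]];
    (* 5040 to 25200 *)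
    [:: Exclude 101 2; Exclude 401 3; Exclude 101 2; Exclude 101 2];
    (* 25200 to 277200 *)
    [:: Exclude 67 2; Exclude 617 3; Exclude 23 5; Exclude 67 2;
      Exclude 67 2; Exclude 23 5; Exclude 23 5; Exclude 23 5;
      Exclude 67 2; Exclude 67 2];
    (* 277200 to 831600 *)
    [:: Lift [:: Exclude 811 3; Exclude 163 2; Lift [:: Exclude 487 3;
      Exclude 487 3; Exclude 487 3]]; Lift [:: Exclude 1297 10;
      Exclude 1783 10; Exclude 1297 10]];
    (* 831600 to 10810800 *)
    [:: Exclude 313 10; Exclude 157 5; Exclude 313 10; Exclude 79 3;
      Exclude 53 2; Exclude 53 2; Exclude 53 2; Exclude 79 3;
      Exclude 53 2; Exclude 79 3; Exclude 859 2; Exclude 53 2];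
    (* 10810800 to 32432400 *)
    [:: Lift [:: Exclude 3889 11; Exclude 487 3; Exclude 12637 2];
      Lift [:: Exclude 487 3; Exclude 3889 11; Exclude 3889 11]];
    (* 32432400 to 97297200 *)
    [:: Lift [:: Exclude 1459 3; Exclude 36451 7; Exclude 32077 2];
      Lift [:: Exclude 2917 5; Exclude 1459 3; Exclude 1459 3]]
  ]%num.

Lemma exponent_sieve_ok : sieve_test 0 2 exponent_sieve.
Proof. by vm_compute. Qed.

Theorem corollary12 (m n : nat) (hm : 0 < m) (hn : 0 < n)
    (hEM : \sum_(1 <= j < m.+1) j ^ n = (m + 1) ^ n)
    (hmod : m = 1 %[mod 3]) :
  m = 1 %[mod 3 ^ 7].
Proof.
have EM : erdos_moser m n.
  rewrite /erdos_moser /power_sum -(big_mkord xpredT (fun j => j ^ n)).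
  by rewrite big_ltn // exp0n // add0n hEM addn1.
have n_even := even_exponent EM hn hmod.
apply: (congruent_1_mod_3_7 EM hn n_even _ hmod).
apply: (sieve_sound EM hn n_even exponent_sieve_ok).
by change (n = 0 %[mod 2]); rewrite modn2 (negbTE n_even).
Qed.
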